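(* Let a reconstruction distribution $Q$ (a probability distribution on $\mathcal Y$), a distortion measure $\rho:\mathcal X\times\mathcal Y\to\mathbb R$ with distortion level $d$, and $\delta\in(0,1)$ be given. Assume that for some $\eta>0$ the minimal $d$-match probability is lower bounded as $\min_{x\in\mathcal X}p(x,Q)>\eta$. Let $X_1,\dots,X_n$ be IID with distribution $P_X$ on $\mathcal X$, and let $\mathcal C_1,\dots,\mathcal C_n$ be random codebooks (independent of each other and of the $X_t$), each with IID codewords drawn from $Q$. Then there exists a numerical constant $c>0$ such that, with probability at least $1-\delta$, $$\left|\frac1n\sum_{t=1}^{n}\log J(X_t,\mathcal C_t)-\tilde b(Q)\right|\le\frac{c}{\eta}\sqrt{\frac1n\log\frac1\delta}.$$
   Context: $\mathcal X$ (source alphabet) and $\mathcal Y$ (reconstruction alphabet) are general alphabets; $\log$ is the natural logarithm. A codebook is an infinite sequence $\mathcal C=(y(1),y(2),\dots)$ of elements of $\mathcal Y$; ''$\mathcal C\sim Q$'' means that the codewords $y(j)$ are IID with distribution $Q$. For $x\in\mathcal X$, the index of the first $d$-match is $J(x,\mathcal C)=\inf\{j\in\{1,2,\dots\}:\rho(x,y(j))\le d\}$ (equal to $\infty$ if there is no such $j$). The $d$-match probability is $p(x,Q)=\mathbb P_{Y\sim Q}[\rho(x,Y)\le d]$. The mean cost is $\tilde b(Q)=\mathbb E_{X\sim P_X,\,\mathcal C\sim Q}[\log J(X,\mathcal C)]$, with $X$ and $\mathcal C$ independent.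
   Formalization: One numerical c for all δ in (0,1) is impossible: as δ→1 the bound tends to 0 while the deviation can stay bounded away from 0. Instead, for each δ0 in (0,1), c depends on δ0 only and the bound holds for all δ in (0,δ0]; ρ is taken jointly measurable. *)

(* Defs.v *)
From HB Require Import structures.
From mathcomp Require Import all_boot all_order all_algebra finmap.
From mathcomp Require Import all_classical all_reals all_analysis.

Set Implicit Arguments.
Unset Strict Implicit.
Unset Printing Implicit Defensive.

Import Order.TTheory GRing.Theory Num.Theory.
Import numFieldNormedType.Exports.

Local Open Scope classical_set_scope.
Local Open Scope ring_scope.

Definition mutually_independent d (W : measurableType d) (R : realType)
    (P : probability W R) (I : choiceType) (F : I -> set (set W)) : Prop :=
  forall (J : {fset I}) (A : I -> set W),
    (forall i, i \in J -> F i (A i)) ->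
    P (\bigcap_(i in [set` J]) A i) = (\prod_(i <- J) P (A i))%E.

Definition sigma_of d (W : measurableType d) d' (T : measurableType d')
    (Z : W -> T) : set (set W) :=
  preimage_set_system [set: W] Z measurable.

Definition iid d (W : measurableType d) (R : realType) (P : probability W R)
    d' (T : measurableType d') (mu : probability T R)
    (I : choiceType) (Z : I -> {RV P >-> T}) : Prop :=
  (forall (i : I) (A : set T), measurable A -> distribution P (Z i) A = mu A)
  /\ mutually_independent P (fun i => sigma_of (Z i)).

Definition codebook_sigma d (W : measurableType d) d' (T : measurableType d')
    (C : nat -> W -> T) : set (set W) :=
  <<s \bigcup_(j in [set: nat]) sigma_of (C j) >>.

(* The X t are IID with law PX, each C t has IID codewords with law Q, and all
   the source symbols X t and whole codebooks C t are jointly independent. *)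
Definition source_codebook_sample d (W : measurableType d) (R : realType)
    (P : probability W R)
    dX (TX : measurableType dX) (PX : probability TX R)
    dY (TY : measurableType dY) (Q : probability TY R)
    (I : choiceType) (X : I -> {RV P >-> TX})
    (C : I -> nat -> {RV P >-> TY}) : Prop :=
  [/\ iid PX X,
      (forall t : I, iid Q (C t)) &
      mutually_independent P (fun k : (I + I)%type =>
        match k with
        | inl t => sigma_of (X t)
        | inr t => codebook_sigma (fun j => C t j : W -> TY)
        end)].

Definition d_match_prob (R : realType) (TX : Type) dY (TY : measurableType dY)
    (rho : TX -> TY -> R) (dist : R) (Q : probability TY R) (x : TX) : \bar R :=
  Q [set y | rho x y <= dist].

(* Codewords are stored from index 0, so y j is the codeword of index j.+1;
   the infimum of the empty set is +oo. *)
Definition first_match (R : realType) (TX TY : Type) (rho : TX -> TY -> R)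
    (dist : R) (x : TX) (y : nat -> TY) : \bar R :=
  ereal_inf [set (j.+1%:R)%:E | j in [set j : nat | rho x (y j) <= dist]].

(* The extended logarithm lne maps +oo to +oo. *)
Definition log_first_match (R : realType) (TX TY : Type) (rho : TX -> TY -> R)
    (dist : R) (x : TX) (y : nat -> TY) : \bar R :=
  lne (first_match rho dist x y).

(* The mean cost depends on X and C only through their joint law: it is the
   quantity E[log J(X, C)] with X ~ PX and C ~ Q independent as soon as
   source_codebook_sample holds of this single pair (X, C). *)
Definition mean_cost d (W : measurableType d) (R : realType)
    (P : probability W R) dX (TX : measurableType dX)
    dY (TY : measurableType dY) (rho : TX -> TY -> R) (dist : R)
    (X : {RV P >-> TX}) (C : nat -> {RV P >-> TY}) : \bar R :=
  (\int[P]_w log_first_match rho dist (X w) (fun j => C j w))%E.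

(* Main.v *)
(* Write J = j + 1 for the index of the first match and Z = log J.  Integrating the
   k-th codeword against Q multiplies the probability of "no match so far" by at
   most 1 - eta, so J has a geometric tail and E exp(a J) <= 1 / (1 - a / eta) for
   0 <= a <= eta / 2.  Since Z^2 <= 4 J, Z is sub-Gaussian: using
   e^x <= x + e^(2 x^2), E exp(lam (Z - E Z)) <= exp(50 lam^2 / eta^2) for every
   real lam.  Independence over the pairs (X_t, C_t) and the Chernoff bound give a
   two-sided deviation probability 2 exp(- n (tau eta)^2 / 200); the factor 2 is
   absorbed in c because log(1/delta) >= log(1/delta0) > 0. *)
Require Import Defs.
From HB Require Import structures.
From mathcomp Require Import all_boot all_order all_algebra finmap.
From mathcomp Require Import all_classical all_reals all_analysis.
From mathcomp Require Import measurable_realfun ring lra.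
Set Implicit Arguments.
Unset Strict Implicit.
Unset Printing Implicit Defensive.
Import Order.TTheory GRing.Theory Num.Theory.
Import numFieldNormedType.Exports.
Local Open Scope classical_set_scope.
Local Open Scope ring_scope.

(** The extended-real [log J] is replaced by the real logarithm of a nat-valued index that takes an
    arbitrary value on the never-matched event, a null set. Countably many values then reduce
    expectations of products to series over fibers, so no product measure over the n pairs is built.
    Two gaps separate the hypotheses from a Chernoff argument. Independence is given for 2n separate
    sigma-algebras, symbols and codebooks, and has to be regrouped into n pairs by a pi-system
    argument. The mean is that of a generic pair on another probability space, so equality of the
    index laws has to be proved, by determining the probabilities of [no match so far] from [PX] and
    [Q]. The cut-off [delta0] is there because the radius vanishes as [delta] tends to 1, while for
    small n the discrete average of [log J] may stay at a positive distance from its mean. *)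

Section superlevel_sets.
Context d (T : measurableType d) (R : realType) (f : T -> R).
Hypothesis mf : measurable_fun setT f.

Lemma measurable_superlevel x : measurable [set t | x <= f t].
Proof.
have := mf measurableT (measurable_itv `[x, +oo[).
by rewrite setTI; congr measurable; apply/seteqP; split => t;
  rewrite /= in_itv/= andbT.
Qed.

Lemma measurable_strict_superlevel x : measurable [set t | x < f t].
Proof.
have := mf measurableT (measurable_itv `]x, +oo[).
by rewrite setTI; congr measurable; apply/seteqP; split => t;
  rewrite /= in_itv/= andbT.
Qed.

End superlevel_sets.

(** * Extending independence from pi-systems to generated sigma-algebras *)

Section independence.
Context d (W : measurableType d) (R : realType) (P : probability W R).

(** With [B] fixed, both sides are finite measures in [A] that agree on a pi-system containing
    [setT], hence on the sigma-algebra it generates. *)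
Lemma independent_g_sigma_algebra (G : set (set W)) (B : set W) :
  G `<=` measurable -> setI_closed G -> G setT -> measurable B ->
  (forall A, G A -> P (A `&` B) = (P A * P B)%E) ->
  forall A, <<s G >> A -> P (A `&` B) = (P A * P B)%E.
Proof.
move=> Gm GI GT mB GB A GA.
have PB0 : 0 <= fine (P B) by rewrite fine_ge0// measure_ge0.
have PBE : (fine (P B))%:E = P B by rewrite fineK// fin_num_measure.
have H : forall C, mscale (NngNum PB0) P C = (P C * P B)%E.
  by move=> C; rewrite /mscale/= PBE muleC.
rewrite -H; apply: (@g_sigma_algebra_measure_unique _ R W G Gm (fun=> setT)
  (fun=> GT) _ (mrestr P mB) (mscale (NngNum PB0) P)) => //.
- by apply: bigcup_const; exists 0%N.
- by move=> C GC; rewrite /= /mrestr GB.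
- by move=> _; rewrite ltey_eq fin_num_measure.
Qed.

(** The generators are upgraded to sigma-algebras one index at a time: the induction runs on the
    list [s] of indices already upgraded, and each step applies the two-event version with [B] the
    intersection of the other events. *)
Lemma independent_family_g_sigma_algebra (I : finType) (G : I -> set (set W)) :
  (forall i, G i `<=` measurable) -> (forall i, setI_closed (G i)) ->
  (forall i, G i setT) ->
  (forall A : I -> set W, (forall i, G i (A i)) ->
    P (\big[setI/setT]_i A i) = (\prod_i P (A i))%E) ->
  forall A : I -> set W, (forall i, <<s G i >> (A i)) ->
    P (\big[setI/setT]_i A i) = (\prod_i P (A i))%E.
Proof.
move=> Gm GI GT Gindep.
have Gsm i : <<s G i >> `<=` measurable.
  by apply: smallest_sub => //; exact: sigma_algebra_measurable.
suff H (s : seq I) : uniq s -> forall A : I -> set W,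
    (forall i, if i \in s then <<s G i >> (A i) else G i (A i)) ->
    P (\big[setI/setT]_i A i) = (\prod_i P (A i))%E.
  move=> A GA; apply: (H (enum I)); first exact: enum_uniq.
  by move=> i; rewrite mem_enum inE.
elim: s => [_ A GA|i s IH /= /andP[si us] A GA]; first exact: Gindep.
have mA j : measurable (A j).
  by have := GA j; case: ifP => _ => [/Gsm|/Gm].
pose B := \big[setI/setT]_(j | j != i) A j.
have mB : measurable B by apply: big_ind => // *; exact: measurableI.
(* As [i] is not in [s], the induction hypothesis applies once [A i] is replaced by a generator
   [C]. *)
have upd C : G i C -> P (C `&` B) = (P C * \prod_(j | j != i) P (A j))%E.
  move=> GC; pose A' j := if j == i then C else A j.
  have GA' j : if j \in s then <<s G j >> (A' j) else G j (A' j).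
    rewrite /A'; have [->|ji] := eqVneq j i; first by rewrite (negPf si).
    by have := GA j; rewrite inE (negPf ji).
  have A'i : A' i = C by rewrite /A' eqxx.
  have A'j j : j != i -> A' j = A j by rewrite /A' => /negPf ->.
  have := IH us A' GA'; rewrite (bigD1 i)//= A'i (eq_bigr _ A'j) => ->.
  rewrite (bigD1 i)//= A'i; congr (_ * _)%E.
  by apply: eq_bigr => j ji; rewrite A'j.
have PB : P B = (\prod_(j | j != i) P (A j))%E.
  by have := upd setT (GT i); rewrite setTI probability_setT mul1e.
rewrite (bigD1 i)//= [RHS](bigD1 i)//= -PB.
apply: (@independent_g_sigma_algebra (G i)) => //.
- by move=> C GC; rewrite upd// PB.
- by have := GA i; rewrite inE eqxx.
Qed.

End independence.

(** * Unnormalised conditional laws *)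

Definition restricted_law d (W : measurableType d) (R : realType)
    (P : probability W R) (S : set W) (mS : measurable S)
    d' (T : measurableType d') (X : {RV P >-> T}) : set T -> \bar R :=
  pushforward (mrestr P mS) X.

Section restricted_law.
Context d (W : measurableType d) (R : realType) (P : probability W R).
Context (S : set W) (mS : measurable S).
Context d' (T : measurableType d') (X : {RV P >-> T}).

Lemma restricted_lawE A : restricted_law mS X A = P (X @^-1` A `&` S).
Proof. by []. Qed.

Let mu : {measure set T -> \bar R} :=
  measure_function_pushforward__canonical__measure_function_Measure
    (mrestr P mS) (measurable_funPT X).

HB.instance Definition _ := isMeasure.Build _ _ _ (restricted_law mS X)
  (measure0 mu) (measure_ge0 mu) (@measure_semi_sigma_additive _ _ _ mu).

Let restricted_law_fin : fin_num_fun (restricted_law mS X).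
Proof.
move=> A mA; rewrite restricted_lawE fin_num_measure//.
apply: measurableI => //.
by rewrite -[X in measurable X]setTI; exact: measurable_funPT.
Qed.

HB.instance Definition _ := Measure_isFinite.Build _ _ _
  (restricted_law mS X) restricted_law_fin.

End restricted_law.

(** On [S], the joint law of [X] and [Y] agrees on rectangles with the product of [restricted_law]
    and [Q], hence everywhere; the integral of sections is that product measure. Not dividing by
    [P S] avoids a separate case when it vanishes. *)
Lemma probability_section d (W : measurableType d) (R : realType)
    (P : probability W R) (S : set W) (mS : measurable S)
    d1 (T1 : measurableType d1) (X : {RV P >-> T1})
    d2 (T2 : measurableType d2) (Y : {RV P >-> T2}) (Q : probability T2 R) :
  (forall A B, measurable A -> measurable B ->
    P (X @^-1` A `&` S `&` Y @^-1` B) = (P (X @^-1` A `&` S) * Q B)%E) ->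
  forall D, measurable D ->
    P ((fun w => (X w, Y w)) @^-1` D `&` S) =
    (\int[restricted_law mS X]_x Q (xsection D x))%E.
Proof.
move=> indep D mD.
have mXY : measurable_fun setT (fun w => (X w, Y w)).
  by apply: measurable_fun_pair; exact: measurable_funPT.
symmetry; apply: (@product_measure_unique _ _ _ _ R (restricted_law mS X) Q
  (measure_function_pushforward__canonical__measure_function_Measure
    (mrestr P mS) mXY)) => // A B mA mB.
rewrite /= /pushforward /mrestr -indep//; congr (P _).
by rewrite setIAC.
Qed.

(** * Probability that the first k codewords all fail to match *)

Definition unmatched (R : realType) (W TX TY : Type) (rho : TX -> TY -> R)
    (dist : R) (X : W -> TX) (C : nat -> W -> TY) (k : nat) : set W :=
  [set w | forall j, (j < k)%N -> dist < rho (X w) (C j w)].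

Section unmatched.
Context (R : realType) dX dY (TX : measurableType dX) (TY : measurableType dY).
Variables (rho : TX -> TY -> R) (dist : R).
Hypothesis mrho : measurable_fun [set: TX * TY] (fun z => rho z.1 z.2).

Let mgt : measurable [set z : TX * TY | dist < rho z.1 z.2].
Proof. exact: (measurable_strict_superlevel mrho). Qed.

Lemma measurable_match x : measurable [set y | rho x y <= dist].
Proof.
rewrite (_ : [set _ | _] = ~` xsection [set z | dist < rho z.1 z.2] x).
  by apply: measurableC; exact: measurable_xsection.
by rewrite xsectionE; apply/seteqP; split => y /=; rewrite leNgt => /negP.
Qed.

(** Only codewords below [k] are assumed measurable, and the sigma-algebra on [W] is free: this is
    applied below to the one generated by [X] and the first [k] codewords. *)
Lemma unmatched_sub d (W : measurableType d) (X : W -> TX) (C : nat -> W -> TY)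
    (k : nat) :
  measurable_fun setT X ->
  (forall j, (j < k)%N -> measurable_fun setT (C j)) ->
  measurable (unmatched rho dist X C k).
Proof.
move=> mX mC.
rewrite [X in measurable X](_ : _ = \big[setI/setT]_(j < k)
    ((fun w => (X w, C j w)) @^-1` [set z | dist < rho z.1 z.2])).
  apply: bigsetI_measurable => j _.
  have mXC : measurable_fun setT (fun w => (X w, C j w)).
    by apply: measurable_fun_pair => //; exact: mC.
  by have := mXC measurableT _ mgt; rewrite setTI.
rewrite -(bigcap_mkord k (fun j =>
  (fun w => (X w, C j w)) @^-1` [set z | dist < rho z.1 z.2])).
by apply/seteqP; split => w /= h j; exact: h.
Qed.

Variables (PX : probability TX R) (Q : probability TY R).

Section one_pair.
Context d (W : measurableType d) (P : probability W R).
Variables (X : {RV P >-> TX}) (C : nat -> {RV P >-> TY}).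
Let E k := unmatched rho dist X (fun j => C j : W -> TY) k.

Lemma measurable_unmatched k : measurable (E k).
Proof. by apply: unmatched_sub. Qed.
Let mE := measurable_unmatched.

Hypothesis indep : forall (k : nat) (A : set TX) (B : nat -> set TY),
  measurable A -> (forall j, measurable (B j)) ->
  P (X @^-1` A `&` \big[setI/setT]_(j < k) (C j @^-1` B j)) =
  (PX A * \prod_(j < k) Q (B j))%E.

Let rect k : set (set W) := [set S | exists A (B : nat -> set TY),
  [/\ measurable A, (forall j, measurable (B j)) &
    S = X @^-1` A `&` \big[setI/setT]_(j < k) (C j @^-1` B j)]].

Let unmatched_rect k A : measurable A -> <<s rect k >> (X @^-1` A `&` E k).
Proof.
move=> mA.
pose T := g_sigma_algebraType (rect k).
have sX B : measurable B -> <<s rect k >> (X @^-1` B).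
  move=> mB; apply: sub_sigma_algebra; exists B, (fun=> setT); split => //.
  by rewrite big1 ?setIT.
have sC j B : (j < k)%N -> measurable B -> <<s rect k >> (C j @^-1` B).
  move=> jk mB; apply: sub_sigma_algebra.
  exists setT, (fun i => if i == j then B else setT); split => //.
    by move=> i; case: ifP.
  rewrite preimage_setT setTI (bigD1 (Ordinal jk))//= eqxx big1 ?setIT// => i.
  by rewrite -val_eqE/= => /negPf ->.
have mX : measurable_fun [set: T] (X : T -> TX).
  by move=> _ B mB; rewrite setTI; exact: sX.
apply: (@measurableI _ T); first exact: sX.
apply: (@unmatched_sub _ T) => // j jk _ B mB.
by rewrite setTI; exact: sC.
Qed.

Let rect_indep k A B : measurable A -> measurable B ->
  P (X @^-1` A `&` E k `&` C k @^-1` B) = (P (X @^-1` A `&` E k) * Q B)%E.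
Proof.
move=> mA mB.
have mCk : measurable (C k @^-1` B).
  by rewrite -[X in measurable X]setTI; exact: measurable_funPT.
have PC : P (C k @^-1` B) = Q B.
  have := @indep k.+1 setT (fun i => if i == k then B else setT) measurableT.
  rewrite preimage_setT setTI probability_setT mul1e !big_ord_recr/= eqxx.
  rewrite big1 => [|i _]; last by rewrite (ltn_eqF (ltn_ord i)).
  rewrite big1 => [|i _]; last by rewrite (ltn_eqF (ltn_ord i)) probability_setT.
  by rewrite setTI mul1e; apply => j; case: ifP.
rewrite -PC; apply: (@independent_g_sigma_algebra _ _ _ P (rect k)) => //.
- move=> S [A' [B' [mA' mB' ->]]]; apply: measurableI.
    by rewrite -[X in measurable X]setTI; exact: measurable_funPT.
  apply: bigsetI_measurable => j _.
  by rewrite -[X in measurable X]setTI; exact: measurable_funPT.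
- move=> S1 S2 [A1 [B1 [mA1 mB1 ->]]] [A2 [B2 [mA2 mB2 ->]]].
  exists (A1 `&` A2), (fun j => B1 j `&` B2 j); split.
  + exact: measurableI.
  + by move=> j; exact: measurableI.
  + by rewrite setIACA -big_split.
- exists setT, (fun=> setT); split => //.
  by rewrite preimage_setT setTI big1.
- move=> S [A' [B' [mA' mB' ->]]]; rewrite PC.
  have := @indep k.+1 A' (fun i => if i == k then B else B' i) mA'.
  rewrite !big_ord_recr/= eqxx setIA.
  rewrite (eq_bigr (fun i : 'I_k => C i @^-1` B' i)) => [|i _]; last first.
    by rewrite (ltn_eqF (ltn_ord i)).
  rewrite [X in (_ * (X * _))%E](eq_bigr (fun i : 'I_k => Q (B' i))) => [|i _];
    last by rewrite (ltn_eqF (ltn_ord i)).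
  by rewrite muleA -indep//; apply => j; case: ifP.
- exact: unmatched_rect.
Qed.

Let q x := Q [set y | dist < rho x y].

(* One-step recursion for the law of X on "no match among the first k codewords";
   iterating it determines these laws from PX and Q alone. *)
Lemma restricted_law_unmatchedS k A : measurable A ->
  P (X @^-1` A `&` E k.+1) = (\int[restricted_law (mE k) X]_(x in A) q x)%E.
Proof.
move=> mA.
(* Putting [A] into [D] makes each section either the failure set of [x] or empty, so the
   restriction to [A] appears as an indicator in the integrand. *)
pose D : set (TX * TY) := [set z | dist < rho z.1 z.2] `&` A `*` setT.
have mD : measurable D by apply: measurableI => //; exact: measurableX.
rewrite integral_mkcond.
transitivity (P ((fun w => (X w, C k w)) @^-1` D `&` E k)).
  congr (P _); apply/seteqP; split => w /=.
    move=> [Aw Ew]; split; first by split => //; exact: Ew.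
    by move=> j jk; apply: Ew; rewrite ltnS ltnW.
  move=> [[Dw [Aw _]] Ew]; split => [|j]; first exact: Aw.
  by rewrite ltnS leq_eqVlt => /predU1P[->//|]; exact: Ew.
rewrite (@probability_section _ _ _ _ _ (mE k) _ _ _ _ _ _ Q)//; last first.
  by move=> A' B' mA' mB'; exact: rect_indep.
apply: eq_integral => x _; rewrite /patch; case: ifPn => xA.
  congr (Q _); rewrite xsectionE; apply/seteqP; split => y /=; first by case.
  by move=> ?; split => //; split => //; rewrite inE in xA.
rewrite (_ : xsection D x = set0) ?measure0//.
rewrite xsectionE; apply/seteqP; split => y //= [_ [Ax _]].
by move: xA; rewrite notin_setE.
Qed.

Lemma unmatched0 A : measurable A -> P (X @^-1` A `&` E 0) = PX A.
Proof.
move=> mA; have := @indep 0%N A (fun=> setT) mA (fun=> measurableT).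
rewrite !big_ord0 mule1 => <-; congr (P (_ `&` _)).
by apply/seteqP; split => w.
Qed.

Lemma unmatched_le (eta : R) : 0 <= eta ->
  (forall x, (eta%:E <= d_match_prob rho dist Q x)%E) ->
  forall k, (P (E k) <= ((1 - eta) ^+ k)%:E)%E.
Proof.
move=> eta0 Qeta.
have qle x : (q x <= (1 - eta)%:E)%E.
  have -> : q x = (1 - d_match_prob rho dist Q x)%E.
    rewrite /q /d_match_prob -probability_setC; last exact: measurable_match.
    by congr (Q _); apply/seteqP; split => y /=; rewrite ltNge => /negP.
  by rewrite EFinB leeB.
elim => [|k IH]; first by rewrite expr0 probability_le1.
have := @restricted_law_unmatchedS k setT measurableT.
rewrite preimage_setT setTI => ->.
have qE : q = Q \o xsection [set z | dist < rho z.1 z.2].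
  by apply/funext => x; rewrite /q/= xsectionE.
have eta1 : 0 <= 1 - eta.
  by rewrite -lee_fin (le_trans _ (qle point))// measure_ge0.
apply: (@le_trans _ _ (\int[restricted_law (mE k) X]_x (1 - eta)%:E)%E).
  apply: ge0_le_integral => //.
  by rewrite qE; exact: measurable_fun_xsection.
rewrite integral_cst//= restricted_lawE preimage_setT setTI exprS EFinM.
by apply: lee_pmul => //; rewrite lee_fin.
Qed.

End one_pair.

(** Needed because the mean cost is computed on a different probability space from the sample. *)
Lemma unmatched_unique
    d (W : measurableType d) (P : probability W R)
    (X : {RV P >-> TX}) (C : nat -> {RV P >-> TY})
    d' (W' : measurableType d') (P' : probability W' R)
    (X' : {RV P' >-> TX}) (C' : nat -> {RV P' >-> TY}) :
  (forall (k : nat) (A : set TX) (B : nat -> set TY),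
    measurable A -> (forall j, measurable (B j)) ->
    P (X @^-1` A `&` \big[setI/setT]_(j < k) (C j @^-1` B j)) =
    (PX A * \prod_(j < k) Q (B j))%E) ->
  (forall (k : nat) (A : set TX) (B : nat -> set TY),
    measurable A -> (forall j, measurable (B j)) ->
    P' (X' @^-1` A `&` \big[setI/setT]_(j < k) (C' j @^-1` B j)) =
    (PX A * \prod_(j < k) Q (B j))%E) ->
  forall k, P (unmatched rho dist X (fun j => C j : W -> TY) k) =
            P' (unmatched rho dist X' (fun j => C' j : W' -> TY) k).
Proof.
move=> indep indep' k.
(* The intersection with an arbitrary [A] makes the induction hypothesis an equality of restricted
   laws, which is what the one-step recursion integrates against. *)
suff H A : measurable A ->
    P (X @^-1` A `&` unmatched rho dist X (fun j => C j : W -> TY) k) =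
    P' (X' @^-1` A `&` unmatched rho dist X' (fun j => C' j : W' -> TY) k).
  by have := H setT measurableT; rewrite !preimage_setT !setTI.
elim: k A => [A mA|k IH A mA]; first by rewrite (unmatched0 indep) ?(unmatched0 indep').
rewrite (restricted_law_unmatchedS indep)// (restricted_law_unmatchedS indep')//.
by apply: eq_measure_integral => B mB _; exact: IH.
Qed.

End unmatched.

(** * A real-valued surrogate for the first-match index *)

Section match_index.
Context (R : realType) (TX TY : Type) (rho : TX -> TY -> R) (dist : R).

(* 0-based position of the first match, with junk value 0 when there is none *)
Definition match_index (x : TX) (y : nat -> TY) : nat :=
  if pselect (exists j, rho x (y j) <= dist) is left h then ex_minn h else 0%N.

Lemma log_first_matchE x y : (exists j, rho x (y j) <= dist) ->
  log_first_match rho dist x y = (ln (match_index x y).+1%:R)%:E.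
Proof.
rewrite /log_first_match /match_index; case: pselect => // h _.
rewrite -lne_EFin ?ltr0n//; congr lne.
case: ex_minnP => m hm minm; apply/eqP; rewrite eq_le; apply/andP; split.
  by apply: ereal_inf_lbound; exists m.
apply: le_ereal_inf_tmp => _ [j /= hj <-]; rewrite lee_fin ler_nat ltnS.
exact: minm.
Qed.

Lemma log_first_match_never x y : (forall j, dist < rho x (y j)) ->
  log_first_match rho dist x y = +oo%E.
Proof.
move=> h; rewrite /log_first_match /first_match.
rewrite (_ : [set j | rho x (y j) <= dist] = set0) ?image_set0 ?ereal_inf0//.
by apply/seteqP; split => j //=; rewrite leNgt h.
Qed.

Context (W : Type) (X : W -> TX) (C : nat -> W -> TY).
Let E := unmatched rho dist X C.
Let N : set W := \bigcap_k E k.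

Lemma never_unmatchedP w : N w <-> forall j, dist < rho (X w) (C j w).
Proof.
split => [h j|h k _ j _]; last exact: h.
by apply: (h j.+1).
Qed.

(** The junk value puts the never-matched event [N] into the fiber over 0. *)
Lemma match_index_preimage k :
  [set w | match_index (X w) (C^~ w) = k] =
  (E k `\` E k.+1) `|` (if k == 0%N then N else set0).
Proof.
apply/seteqP; split => w /=.
  rewrite /match_index; case: pselect => [h|h].
    case: ex_minnP => m hm minm <-; left; split.
      by move=> j jm; rewrite ltNge; apply: contraL jm => /minm; rewrite -leqNgt.
    by move=> /(_ m (ltnSn m)); rewrite ltNge hm.
  move=> <-; right; rewrite eqxx; apply/never_unmatchedP => j.
  by rewrite ltNge; apply/negP => hj; apply: h; exists j.
have first : (E k `\` E k.+1) w -> match_index (X w) (C^~ w) = k.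
  move=> [Ekw nEw].
  have hk : rho (X w) (C k w) <= dist.
    rewrite leNgt; apply/negP => hk; apply: nEw => j.
    by rewrite ltnS leq_eqVlt => /predU1P[->//|]; exact: Ekw.
  rewrite /match_index; case: pselect => [h|[]]; last by exists k.
  case: ex_minnP => m hm minm; apply/eqP; rewrite eqn_leq minm// leqNgt.
  by apply/negP => /Ekw; rewrite ltNge hm.
case=> //; case: eqP => // -> /never_unmatchedP h.
rewrite /match_index; case: pselect => // e; have [j hj] := e.
by have := h j; rewrite ltNge hj.
Qed.

(** Only an inclusion: a never-matched outcome lies in [E k] but has junk index 0. *)
Lemma match_index_ge k : (0 < k)%N ->
  [set w | (k <= match_index (X w) (C^~ w))%N] `<=` E k.
Proof.
move=> k0 w /=; rewrite /match_index; case: pselect => [h|h]; last first.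
  by rewrite leqNgt k0.
case: ex_minnP => m hm minm km j jk; rewrite ltNge; apply/negP => /minm.
by rewrite leqNgt (leq_trans jk km).
Qed.

End match_index.

(** * Measurability and law of the match index *)

Section match_index_law.
Context (R : realType) dX dY (TX : measurableType dX) (TY : measurableType dY).
Variables (rho : TX -> TY -> R) (dist : R).
Hypothesis mrho : measurable_fun [set: TX * TY] (fun z => rho z.1 z.2).

Lemma measurable_match_index_preimage d (W : measurableType d)
    (X : W -> TX) (C : nat -> W -> TY) k :
  measurable_fun setT X -> (forall j, measurable_fun setT (C j)) ->
  measurable [set w | match_index rho dist (X w) (C^~ w) = k].
Proof.
move=> mX mC.
have mE i : measurable (unmatched rho dist X C i) by exact: unmatched_sub.
rewrite match_index_preimage; apply: measurableU; first exact: measurableD.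
by case: ifP => // _; exact: bigcap_measurable.
Qed.

Lemma measurable_match_index d (W : measurableType d)
    (X : W -> TX) (C : nat -> W -> TY) :
  measurable_fun setT X -> (forall j, measurable_fun setT (C j)) ->
  measurable_fun setT (fun w => match_index rho dist (X w) (C^~ w)).
Proof.
move=> mX mC _ A _; rewrite setTI.
rewrite (_ : _ @^-1` A = \bigcup_(k in A)
    [set w | match_index rho dist (X w) (C^~ w) = k]).
  by apply: bigcup_measurable => k _; exact: measurable_match_index_preimage.
apply/seteqP; split => w /=; first by move=> Aw; exists (match_index rho dist (X w) (C^~ w)).
by move=> [k Ak ->].
Qed.

Context d (W : measurableType d) (P : probability W R).
Variables (X : {RV P >-> TX}) (C : nat -> {RV P >-> TY}).
Let E k := unmatched rho dist X (fun j => C j : W -> TY) k.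
Let N : set W := \bigcap_k E k.

Lemma never_unmatched_negligible (r : R) : 0 <= r < 1 ->
  (forall k, (P (E k) <= (r ^+ k)%:E)%E) -> P N = 0%E.
Proof.
move=> /andP[r0 r1] Er; apply/eqP; rewrite eq_le measure_ge0 andbT.
have mE k : measurable (E k) by exact: unmatched_sub.
have mN : measurable N by exact: bigcap_measurable.
have Nr k : (P N <= (r ^+ k)%:E)%E.
  by apply: le_trans (Er k); apply: le_measure; rewrite ?inE//; exact: bigcap_inf.
have : (fine (P N) <= 0)%R.
  apply: (@ler_cvg_to _ \oo _ R (fun=> fine (P N)) (fun k : nat => r ^+ k)).
  - exact: cvg_cst.
  - by apply: cvg_expr; rewrite ger0_norm.
  - by near=> k; rewrite -lee_fin fineK ?fin_num_measure.
by rewrite -lee_fin fineK// fin_num_measure.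
Unshelve. all: by end_near. Qed.

(** Since [N] is null, the junk part of the fiber over 0 has no mass. The law of the index is thus a
    function of the numbers [P (E k)] alone, which [unmatched_unique] carries between probability
    spaces. *)
Lemma probability_match_index k : P N = 0%E ->
  P [set w | match_index rho dist (X w) (fun j => C j w) = k] =
  (P (E k) - P (E k.+1))%E.
Proof.
move=> PN.
have mE i : measurable (E i) by exact: unmatched_sub.
have mN : measurable N by exact: bigcap_measurable.
rewrite match_index_preimage -/(E k) -/(E k.+1) -/N.
have -> : P (E k `\` E k.+1 `|` (if k == 0%N then N else set0)) =
    P (E k `\` E k.+1).
  apply: measureU0 => //; first exact: measurableD.
    by case: ifP.
  by case: ifP.
rewrite measureD//; last by rewrite ltey_eq fin_num_measure.
congr (_ - P _)%E; apply/setIidPr => w h j jk.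
by apply: h; rewrite ltnS ltnW.
Qed.

End match_index_law.

(** * Expectations of products of functions of nat-valued variables *)

Section nat_random_variables.
Context d (W : measurableType d) (R : realType) (P : probability W R).

Lemma measurable_nat_preimage (j : W -> nat) (A : set nat) :
  measurable_fun setT j -> measurable [set w | A (j w)].
Proof. by move=> mj; have := mj measurableT A I; rewrite setTI. Qed.

Let measurable_fiber (j : W -> nat) k : measurable_fun setT j ->
  measurable [set w | j w = k].
Proof. exact: (measurable_nat_preimage [set k]). Qed.

(** The factor [h] carries the coordinates not yet integrated, and [S] the conditioning already
    done. *)
Lemma ge0_integral_nat_fibers (j : W -> nat) (f : nat -> R) (h : W -> \bar R)
    (S : set W) : measurable_fun setT j -> (forall k, 0 <= f k) ->
  measurable_fun setT h -> (forall w, 0%E <= h w)%E -> measurable S ->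
  (\int[P]_(w in S) ((f (j w))%:E * h w) =
   \sum_(k <oo) (f k)%:E * \int[P]_(w in S `&` [set w | j w = k]) h w)%E.
Proof.
move=> mj f0 mh h0 mS; pose F k := S `&` [set w | j w = k].
have mF k : measurable (F k) by apply: measurableI => //; exact: measurable_fiber.
have mfj : measurable_fun setT (fun w => (f (j w))%:E).
  by apply/measurable_EFinP; exact: (measurableT_comp (f := f)).
have SE : S = \bigcup_k F k.
  by apply/seteqP; split => [w Sw|w [k _ []]//]; exists (j w).
rewrite [in LHS]SE ge0_integral_bigcup//.
- apply: eq_eseriesr => k _.
  rewrite (@eq_integral _ _ _ P _ (fun w => (f k)%:E * h w)%E).
    by rewrite ge0_integralZl ?lee_fin//; exact: measurable_funTS.
  by move=> w; rewrite inE => -[_ /= ->].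
- by apply: measurable_funTS; exact: emeasurable_funM.
- by move=> w _; rewrite mule_ge0 ?lee_fin.
- by apply/trivIsetP => i k _ _ ik; apply/seteqP; split => w //= [[_ /= ji] [_ /= jk]];
    move: ik; rewrite -ji jk eqxx.
Qed.

(* Conditioning on the values of the indices already removed from s replaces S
   by a smaller event and c by its probability, so the statement is stable under
   induction on s. *)
Lemma ge0_integral_prod_le (I : eqType) (j : I -> W -> nat) (f : I -> nat -> R)
    (M : I -> R) :
  (forall i, measurable_fun setT (j i)) -> (forall i k, 0 <= f i k) ->
  (forall i, 0 <= M i) ->
  (forall i, (\int[P]_w (f i (j i w))%:E <= (M i)%:E)%E) ->
  forall s : seq I, uniq s -> forall (S : set W) (c : R), measurable S -> 0 <= c ->
  (forall k : I -> nat,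
    (P (S `&` \big[setI/setT]_(i <- s) [set w | j i w = k i]) <=
     c%:E * \prod_(i <- s) P [set w | j i w = k i])%E) ->
  (\int[P]_(w in S) (\prod_(i <- s) f i (j i w))%:E <=
   (c * \prod_(i <- s) M i)%:E)%E.
Proof.
move=> mj f0 M0 fM; elim => [_ S c mS c0 hS|i s IH /= /andP[si us] S c mS c0 hS].
  rewrite (eq_integral (cst 1%E)) => [|w _]; last by rewrite big_nil.
  rewrite integral_cst// mul1e big_nil mulr1.
  by have := hS (fun=> 0%N); rewrite !big_nil setIT mule1.
have pf0 w : 0 <= \prod_(t <- s) f t (j t w) by apply: prodr_ge0.
have PM0 : 0 <= \prod_(t <- s) M t by apply: prodr_ge0.
have mpf : measurable_fun setT (fun w => (\prod_(t <- s) f t (j t w))%:E).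
  apply/measurable_EFinP; apply: measurable_prod => t _.
  exact: (measurableT_comp (f := f t)).
under eq_integral do rewrite big_cons EFinM.
rewrite ge0_integral_nat_fibers//.
have Pfin k : P [set w | j i w = k] \is a fin_num.
  by rewrite fin_num_measure//; exact: measurable_fiber.
apply: (@le_trans _ _ (\sum_(k <oo) ((c * \prod_(t <- s) M t)%:E *
    ((f i k)%:E * P [set w | j i w = k]))%E)%E).
  apply: lee_nneseries => [k _ _|k _].
    by rewrite mule_ge0 ?lee_fin// integral_ge0// => w _; rewrite lee_fin.
  rewrite muleCA; apply: lee_pmul => //; first by rewrite lee_fin.
    by apply: integral_ge0 => w _; rewrite lee_fin.
  rewrite -(fineK (Pfin k)) -EFinM mulrAC.
  apply: IH => //; first by apply: measurableI => //; exact: measurable_fiber.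
    by rewrite mulr_ge0// fine_ge0// measure_ge0.
  (* The value at [i] is prescribed as [k]; since [i] is not in [s], the other constraints are
     unaffected. *)
  move=> kk; have := hS (fun t => if t == i then k else kk t).
  rewrite !big_cons eqxx setIA.
  rewrite (eq_big_seq (fun t => [set w | j t w = kk t])); last first.
    by move=> t ts; case: eqP => // ti; move: si; rewrite -ti ts.
  rewrite (eq_big_seq (fun t => P [set w | j t w = kk t])); last first.
    by move=> t ts; case: eqP => // ti; move: si; rewrite -ti ts.
  by rewrite EFinM fineK// muleA.
rewrite nneseriesZl => [|k _]; last by rewrite mule_ge0 ?lee_fin// measure_ge0.
rewrite (_ : (\sum_(k <oo) (f i k)%:E * P [set w | j i w = k])%E =
    \int[P]_w (f i (j i w))%:E)%E; last first.
  transitivity (\int[P]_w ((f i (j i w))%:E * cst 1 w))%E; last first.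
    by under eq_integral do rewrite mule1.
  rewrite ge0_integral_nat_fibers//.
  apply: eq_eseriesr => k _.
  by rewrite integral_cst ?mul1e ?setTI//; exact: measurable_fiber.
rewrite big_cons mulrCA [leRHS]EFinM muleC.
by apply: lee_wpmul2r => //; rewrite lee_fin mulr_ge0.
Qed.

End nat_random_variables.

(** * Elementary inequalities for the exponential and the logarithm *)

Section real_inequalities.
Context (R : realType).
Implicit Types x : R.

Lemma mul1B_expR_le1 x : (1 - x) * expR x <= 1.
Proof.
rewrite -[leRHS](expRxMexpNx_1 x) mulrC ler_wpM2l ?expR_ge0//.
by have := expR_ge1Dx (- x); lra.
Qed.

(** The coefficient 2 makes two cases meet at [x = 1 / 2]. Below it, [expR x <= (1 - x)^-1 <= 1 + x
    + 2 * x ^+ 2], because multiplying the right side by [1 - x] gives [1 + x ^+ 2 * (1 - 2 * x)].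
    Above it, [x <= 2 * x ^+ 2]. *)
Lemma expR_le_addr_sqr x : expR x <= x + expR (2 * x ^+ 2).
Proof.
have [x2|x2] := lerP x (1 / 2).
  suff : expR x <= x + (1 + 2 * x ^+ 2).
    by move/le_trans; apply; rewrite lerD2l expR_ge1Dx.
  have e := mul1B_expR_le1 x.
  have x0 : 0 < 1 - x by lra.
  rewrite -(ler_pM2l x0); apply: (le_trans e).
  have := sqr_ge0 x; nra.
have : expR x <= expR (2 * x ^+ 2) by rewrite ler_expR; nra.
by lra.
Qed.

(** Halving the logarithm: [ln x] is twice [ln (Num.sqrt x)], which is less than [Num.sqrt x]. *)
Lemma sqr_ln_le x : 1 <= x -> ln x ^+ 2 <= 4 * x.
Proof.
move=> x1; have x0 : 0 < x by lra.
have sx0 : 0 < Num.sqrt x by rewrite sqrtr_gt0.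
have E : ln x = ln (Num.sqrt x) *+ 2 by rewrite -lnXn// sqr_sqrtr// ltW.
have l0 : 0 <= ln x by exact: ln_ge0.
have := ln_sublinear sx0; have := sqr_sqrtr (ltW x0).
set s := Num.sqrt x in E sx0 *; move: (ln s) E => l E s2 ls.
by rewrite E -[in leRHS]s2; rewrite E in l0; nra.
Qed.

Lemma invr1B_le_expR x : 0 <= x <= 1 / 2 -> (1 - x)^-1 <= expR (2 * x).
Proof.
move=> /andP[x0 x1]; have x2 : 0 < 1 - x by lra.
rewrite -(ler_pM2l x2) divff ?gt_eqF//.
by have := expR_ge1Dx (2 * x); nra.
Qed.

End real_inequalities.

(** * Sub-Gaussian moment bound for the logarithm of one index *)

Section sub_gaussian_log_index.
Context d (W : measurableType d) (R : realType) (P : probability W R).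
Variables (j : W -> nat) (eta : R).
Hypothesis mj : measurable_fun setT j.
Hypothesis eta01 : 0 < eta <= 1.
Hypothesis j_ge : forall k, (0 < k)%N ->
  (P [set w | (k <= j w)%N] <= ((1 - eta) ^+ k)%:E)%E.

Let measurable_nat (f : nat -> R) : measurable_fun setT (fun w => (f (j w))%:E).
Proof. by apply/measurable_EFinP; exact: (measurableT_comp (f := f)). Qed.

(** Summation by parts writes the exponential as [expR a] plus increments [c i] over [i < j w], so
    its expectation involves only tail probabilities and is dominated by a geometric series of ratio
    [r]. *)
Lemma geometric_tail_mgf (a : R) : 0 <= a <= eta / 2 ->
  (\int[P]_w (expR (a * (j w).+1%:R))%:E <= ((1 - a / eta)^-1)%:E)%E.
Proof.
move=> /andP[a0 a1]; have /andP[eta0 eta1] := eta01.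
pose b := expR a - 1; pose r := expR a * (1 - eta).
have b0 : 0 <= b by have := expR_ge1Dx a; rewrite /b; lra.
have ae := mul1B_expR_le1 a.
have e0 := expR_gt0 a.
have r0 : 0 <= r by rewrite /r; nra.
(* Since [a < eta], [r] is below [expR a * (1 - a)], which is at most 1. *)
have r1 : r < 1 by rewrite /r; nra.
pose c i := b * expR a ^+ i.+1.
have c0 i : 0 <= c i by rewrite mulr_ge0// exprn_ge0// expR_ge0.
have finite_sum k : expR a + \sum_(i < k) c i = expR (a * k.+1%:R).
  elim: k => [|k IH]; first by rewrite big_ord0 addr0 mulr1.
  rewrite big_ord_recr/= addrA IH /c /b -!expRM_natr.
  rewrite [in RHS]mulrS mulrDr mulr1 expRD; ring.
have pointwise w : ((expR (a * (j w).+1%:R))%:E =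
    (expR a)%:E + \sum_(i <oo) (if (i < j w)%N then (c i)%:E else 0))%E.
  rewrite (nneseries_split 0 (j w)) => [|k _]; last by case: ifP; rewrite ?lee_fin.
  rewrite add0n eseries0 ?adde0 => [|i]; last first.
    by rewrite leqNgt => /negPf ->.
  rewrite big_mkord (eq_bigr (fun i : 'I_(j w) => (c i)%:E)) => [|i _].
    by rewrite sumEFin -EFinD finite_sum.
  by rewrite ltn_ord.
have mgt i : measurable [set w | (i < j w)%N].
  exact: (measurable_nat_preimage [set k | (i < k)%N]).
have mterm i : measurable_fun setT
    (fun w => if (i < j w)%N then (c i)%:E else 0%E).
  have := measurable_nat (fun k => if (i < k)%N then c i else 0).
  by apply: eq_measurable_fun => w _; case: ifP.
under eq_integral do rewrite pointwise.
rewrite ge0_integralD//; last 2 first.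
- by move=> w _; apply: nneseries_ge0 => k _ _; case: ifP; rewrite ?lee_fin.
- have := measurable_nat (fun k => expR (a * k.+1%:R) - expR a).
  apply: eq_measurable_fun => w _.
  by rewrite EFinB pointwise addeAC subee ?add0e.
have -> : (\int[P]_w (expR a)%:E = (expR a)%:E)%E.
  rewrite integral_cst// -[RHS]mule1; congr (_ * _)%E; exact: probability_setT.
rewrite integral_nneseries//; last by move=> k w _; case: ifP; rewrite ?lee_fin.
(* The event [i < j w] is [i.+1 <= j w], so its tail exponent matches the power of [expR a] in
   [c i]. *)
have term_le i : (\int[P]_w (if (i < j w)%N then (c i)%:E else 0) <=
    (b * r ^+ i.+1)%:E)%E.
  rewrite -[leLHS]/(\int[P]_w (fun w => if (i < j w)%N then (c i)%:E else 0) w)%E.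
  rewrite (_ : (fun _ => _) = cst (c i)%:E \_ [set w | (i < j w)%N]); last first.
    by apply/funext => w; rewrite /patch mem_setE.
  rewrite -integral_mkcond integral_cst//.
  rewrite /r exprMn mulrA [leRHS]EFinM; apply: lee_wpmul2l; first by rewrite lee_fin.
  exact: j_ge.
have sum_le : (\sum_(i <oo) (b * r ^+ i.+1)%:E <= (b * r / (1 - r))%:E)%E.
  apply: lime_le.
    by apply: is_cvg_nneseries => i _ _; rewrite lee_fin mulr_ge0// exprn_ge0.
  apply: nearW => N; rewrite sumEFin lee_fin big_mkord.
  suff -> : \sum_(i < N) b * r ^+ i.+1 = b * r / (1 - r) * (1 - r ^+ N).
    rewrite ler_piMr//; first by rewrite divr_ge0 ?mulr_ge0//; lra.
    by rewrite gerBl exprn_ge0.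
  have r1' : 1 - r != 0 by rewrite subr_eq0 eq_sym lt_eqF.
  elim: N => [|N IH]; first by rewrite big_ord0 expr0 subrr mulr0.
  by rewrite big_ord_recr/= IH !exprS; field.
apply: (@le_trans _ _ (expR a + b * r / (1 - r))%:E).
  rewrite EFinD leeD2l//; apply: le_trans sum_le.
  apply: lee_nneseries => [i _ _|i _]; last exact: term_le.
  by apply: integral_ge0 => w _; case: ifP; rewrite ?lee_fin.
have r1' : 0 < 1 - r by lra.
have ea : 0 < 1 - a / eta by rewrite subr_gt0 ltr_pdivrMr//; lra.
(* After clearing denominators, the remaining inequality is again [(1 - a) * expR a <= 1]. *)
rewrite lee_fin (_ : expR a + b * r / (1 - r) = (expR a * eta) / (1 - r)); last first.
  by rewrite /b /r; field; rewrite -/r gt_eqF.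
rewrite ler_pdivrMr// -(ler_pM2l ea) [leRHS]mulrA divff ?gt_eqF// mul1r.
have -> : (1 - a / eta) * (expR a * eta) = expR a * (eta - a).
  by field; rewrite gt_eqF.
by rewrite /r; nra.
Qed.

Let Z w : R := ln (j w).+1%:R.

Let Z_ge0 w : 0 <= Z w.
Proof. by apply: ln_ge0; rewrite ler1n. Qed.

Let mean := (\int[P]_w (Z w)%:E)%E.

(** From [Z <= J <= (2 / eta) * expR (eta / 2 * J)] and the exponential moment at [a = eta / 2],
    which is at most 2. A crude order [1 / eta] is enough, since the mean enters later only through
    its square, on the scale [1 / eta ^+ 2]. *)
Lemma mean_log_le : (mean <= (4 / eta)%:E)%E.
Proof.
have /andP[eta0 eta1] := eta01.
apply: (@le_trans _ _ (\int[P]_w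
    ((2 / eta)%:E * (expR (eta / 2 * (j w).+1%:R))%:E))%E).
  apply: ge0_le_integral => //.
  - by move=> w _; rewrite lee_fin.
  - exact: (measurable_nat (fun k => ln k.+1%:R)).
  - have := measurable_nat (fun k => 2 / eta * expR (eta / 2 * k.+1%:R)).
    by apply: eq_measurable_fun => w _; rewrite EFinM.
  move=> w _; rewrite -EFinM lee_fin.
  have J1 : 1 <= (j w).+1%:R :> R by rewrite ler1n.
  have := expR_ge1Dx (eta / 2 * (j w).+1%:R); rewrite /Z.
  have := ln_sublinear (lt_le_trans ltr01 J1).
  set J := (j w).+1%:R; set l := ln J; set e := expR _ => lJ eJ.
  apply: (@le_trans _ _ J); first exact: ltW.
  rewrite -(@ler_pM2l _ (eta / 2)) ?divr_gt0// mulrA.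
  have -> : eta / 2 * (2 / eta) = 1 by field; rewrite gt_eqF.
  by rewrite mul1r; apply: le_trans eJ; rewrite lerDr ler01.
rewrite ge0_integralZl_EFin//; last 2 first.
- exact: (measurable_nat (fun k => expR (eta / 2 * k.+1%:R))).
- by rewrite divr_ge0// ltW.
apply: (@le_trans _ _ ((2 / eta)%:E * 2%:E)%E).
  apply: lee_wpmul2l; first by rewrite lee_fin divr_ge0// ltW.
  apply: le_trans (geometric_tail_mgf _) _; first by lra.
  have -> : eta / 2 / eta = 1 / 2 by field; rewrite gt_eqF.
  by rewrite lee_fin (_ : (1 - 1 / 2)^-1 = 2 :> R)//; field.
by rewrite -EFinM lee_fin; lra.
Qed.

Lemma log_index_mgf (m lam : R) : mean = m%:E ->
  (\int[P]_w (expR (lam * (Z w - m)))%:E <=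
   (expR (50 * lam ^+ 2 / eta ^+ 2))%:E)%E.
Proof.
(* For 16 lam^2 <= eta, expR_le_addr_sqr cancels the linear term and leaves the
   exponential moment of (Z - m)^2 <= 4 J + m^2; for larger lam, AM-GM bounds
   lam (Z - m) by 2 lam^2 / eta + eta (Z - m)^2 / 8. *)
move=> mE; have /andP[eta0 eta1] := eta01.
have m0 : 0 <= m by rewrite -lee_fin -mE integral_ge0// => w _; rewrite lee_fin.
have mle : m * eta <= 4.
  by have := mean_log_le; rewrite mE lee_fin -ler_pdivlMr.
have etaV1 : 1 <= eta^-1 by rewrite invf_ge1.
have m2 : m ^+ 2 <= 16 / eta ^+ 2.
  rewrite ler_pdivlMr ?exprn_gt0// -exprMn.
  have : 0 <= m * eta by rewrite mulr_ge0// ltW.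
  by move: (m * eta) mle => x; nra.
have e12 : eta^-1 <= eta^-1 ^+ 2 by nra.
have sqr_le w : (Z w - m) ^+ 2 <= 4 * (j w).+1%:R + m ^+ 2.
  have : Z w ^+ 2 <= 4 * (j w).+1%:R by apply: sqr_ln_le; rewrite ler1n.
  by have := Z_ge0 w; nra.
have mmgf (a : R) : measurable_fun setT (fun w => (expR (a * (j w).+1%:R))%:E).
  exact: (measurable_nat (fun k => expR (a * k.+1%:R))).
have mgf_fact (a c : R) : (\int[P]_w (expR (a * (j w).+1%:R + c))%:E =
    (expR c)%:E * \int[P]_w (expR (a * (j w).+1%:R))%:E)%E.
  rewrite -ge0_integralZl_EFin ?expR_ge0//.
  by apply: eq_integral => w _; rewrite expRD mulrC EFinM.
set K := lam ^+ 2 / eta ^+ 2.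
have K0 : 0 <= K by rewrite divr_ge0 ?sqr_ge0.
have lamK : lam ^+ 2 / eta <= K.
  by rewrite /K -exprVn; apply: ler_wpM2l; rewrite ?sqr_ge0.
have [small|large] := lerP (16 * lam ^+ 2) eta; last first.
  apply: (@le_trans _ _ (\int[P]_w
      (expR (eta / 2 * (j w).+1%:R + (2 * (lam ^+ 2 / eta) + 2 / eta)))%:E)%E).
    apply: ge0_le_integral => //.
    - exact: (measurable_nat (fun k => expR (lam * (ln k.+1%:R - m)))).
    - exact: (measurable_nat (fun k => expR (eta / 2 * k.+1%:R + _))).
    move=> w _; rewrite lee_fin ler_expR; have := sqr_le w.
    set z := Z w - m; set J := (j w).+1%:R => zJ.
    (* The weight [eta / 8] turns the [4 * J] of [sqr_le] into [eta / 2 * J], the largest exponent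
       that [geometric_tail_mgf] admits. *)
    have amgm : lam * z <= 2 * (lam ^+ 2 / eta) + eta / 8 * z ^+ 2.
      rewrite -(ler_pM2l eta0) [leRHS](_ : _ = 2 * lam ^+ 2 + eta ^+ 2 / 8 * z ^+ 2).
        have := sqr_ge0 (4 * lam - eta * z); nra.
      by field; rewrite gt_eqF.
    have : eta / 8 * m ^+ 2 <= 2 / eta.
      rewrite (_ : 2 / eta = eta / 8 * (16 / eta ^+ 2)); last first.
        by field; rewrite gt_eqF.
      by apply: ler_wpM2l => //; lra.
    have : eta / 8 * z ^+ 2 <= eta / 8 * (4 * J + m ^+ 2).
      by apply: ler_wpM2l => //; lra.
    by lra.
  rewrite mgf_fact.
  apply: (@le_trans _ _ ((expR (2 * (lam ^+ 2 / eta) + 2 / eta))%:E * (expR 1)%:E)%E).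
    apply: lee_wpmul2l; first by rewrite lee_fin expR_ge0.
    apply: le_trans (geometric_tail_mgf _) _; first by lra.
    have -> : eta / 2 / eta = 1 / 2 by field; rewrite gt_eqF.
    rewrite lee_fin; apply: (@le_trans _ _ (expR (2 * (1 / 2)))).
      by apply: invr1B_le_expR; lra.
    by rewrite ler_expR; lra.
  rewrite -EFinM -expRD lee_fin ler_expR -mulrA -/K.
  (* Origin of the 50: with [1 <= eta^-1 <= 16 * K], the three terms [2 * (lam ^+ 2 / eta)],
     [2 / eta] and 1 cost at most 2, 32 and 16 times [K]. *)
  have : eta^-1 <= 16 * K.
    rewrite /K mulrA; apply: (@le_trans _ _ (eta / eta ^+ 2)).
      by rewrite expr2 invfM mulrA divff ?mul1r// gt_eqF.
    by apply: ler_wpM2r; [rewrite invr_ge0 sqr_ge0|exact: ltW].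
  by lra.
(* The coefficient of [J] in [2 * lam ^+ 2 * (4 * J + m ^+ 2)]; the case condition says exactly
   [a <= eta / 2]. *)
pose a := 8 * lam ^+ 2.
have a0 : 0 <= a by rewrite mulr_ge0 ?sqr_ge0.
have a2 : a <= eta / 2 by rewrite /a; lra.
have mlin : measurable_fun setT (fun w => (lam * (Z w - m))%:E).
  exact: (measurable_nat (fun k => lam * (ln k.+1%:R - m))).
have mexp : measurable_fun setT
    (fun w => (expR (a * (j w).+1%:R + 2 * lam ^+ 2 * m ^+ 2))%:E).
  exact: (measurable_nat (fun k => expR (a * k.+1%:R + _))).
have intZ : P.-integrable setT (fun w => (Z w)%:E).
  apply/integrableP; split; first exact: (measurable_nat (fun k => ln k.+1%:R)).
  apply: le_lt_trans (ltry m); rewrite -mE.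
  apply: ge0_le_integral => //=; first exact: (measurable_nat (fun k => `|ln k.+1%:R|)).
    exact: (measurable_nat (fun k => ln k.+1%:R)).
  by move=> w _; rewrite ger0_norm.
have intlin : P.-integrable setT (fun w => (lam * (Z w - m))%:E).
  under eq_fun do rewrite EFinM EFinB.
  apply: integrableZl => //; apply: integrableB => //.
  exact: finite_measure_integrable_cst.
have lin0 : (\int[P]_w (lam * (Z w - m))%:E = 0)%E.
  under eq_integral do rewrite EFinM EFinB.
  rewrite integralZl//; last first.
    apply: integrableB => //; exact: finite_measure_integrable_cst.
  rewrite integralB//; last exact: finite_measure_integrable_cst.
  have -> : (\int[P]_w m%:E = m%:E)%E.
    rewrite integral_cst// -[RHS]mule1; congr (_ * _)%E; exact: probability_setT.
  by rewrite -/mean mE subee// mule0.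
(* The 48 is 32 from the constant term, by [m2], plus 16 from [2 * (a / eta)]. *)
have exp_le : (\int[P]_w (expR (a * (j w).+1%:R + 2 * lam ^+ 2 * m ^+ 2))%:E <=
    (expR (48 * K))%:E)%E.
  rewrite mgf_fact.
  apply: (@le_trans _ _ ((expR (2 * lam ^+ 2 * m ^+ 2))%:E *
      (expR (2 * (a / eta)))%:E)%E).
    apply: lee_wpmul2l; first by rewrite lee_fin expR_ge0.
    apply: le_trans (geometric_tail_mgf _) _; first by rewrite a0.
    rewrite lee_fin; apply: invr1B_le_expR.
    by apply/andP; split; [rewrite divr_ge0// ltW|rewrite ler_pdivrMr//; lra].
  rewrite -EFinM -expRD lee_fin ler_expR.
  have : lam ^+ 2 * m ^+ 2 <= lam ^+ 2 * (16 / eta ^+ 2).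
    by apply: ler_wpM2l; rewrite ?sqr_ge0.
  have -> : lam ^+ 2 * (16 / eta ^+ 2) = 16 * K by rewrite /K mulrCA.
  have -> : 2 * (a / eta) = 16 * (lam ^+ 2 / eta) by rewrite /a; field; rewrite gt_eqF.
  by rewrite -(mulrA 2); lra.
have intexp : P.-integrable setT
    (fun w => (expR (a * (j w).+1%:R + 2 * lam ^+ 2 * m ^+ 2))%:E).
  apply/integrableP; split => //.
  apply: le_lt_trans (ltry (expR (48 * K))); apply: le_trans exp_le.
  apply: ge0_le_integral => //=.
    exact: (measurable_nat (fun k => `|expR (a * k.+1%:R + _)|)).
  by move=> w _; rewrite ger0_norm ?expR_ge0.
apply: (@le_trans _ _ (\int[P]_w ((lam * (Z w - m))%:E +
    (expR (a * (j w).+1%:R + 2 * lam ^+ 2 * m ^+ 2))%:E))%E).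
  apply: ge0_le_integral => //.
  - exact: (measurable_nat (fun k => expR (lam * (ln k.+1%:R - m)))).
  - exact: emeasurable_funD.
  move=> w _; rewrite -EFinD lee_fin.
  apply: le_trans (expR_le_addr_sqr _) _; rewrite lerD2l ler_expR exprMn.
  have := ler_wpM2l (sqr_ge0 lam) (sqr_le w); rewrite /a; lra.
rewrite integralD// lin0 add0e; apply: le_trans exp_le _.
by rewrite lee_fin ler_expR -mulrA -/K; lra.
Qed.

End sub_gaussian_log_index.

(** * Chernoff bound for the sum of log indices *)

Section concentration.
Context d (W : measurableType d) (R : realType) (P : probability W R).
Variables (n : nat) (j : 'I_n -> W -> nat) (eta m : R).
Hypothesis n_gt0 : (0 < n)%N.
Hypothesis mj : forall t, measurable_fun setT (j t).
Hypothesis eta01 : 0 < eta <= 1.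
Hypothesis j_ge : forall t k, (0 < k)%N ->
  (P [set w | (k <= j t w)%N] <= ((1 - eta) ^+ k)%:E)%E.
Hypothesis j_indep : forall k : 'I_n -> nat,
  P (\big[setI/setT]_t [set w | j t w = k t]) =
  (\prod_t P [set w | j t w = k t])%E.
Hypothesis j_mean : forall t, (\int[P]_w (ln (j t w).+1%:R)%:E = m%:E)%E.

Let S w : R := \sum_t (ln (j t w).+1%:R - m).

Let mS : measurable_fun setT S.
Proof.
apply: measurable_sum => t.
exact: (measurableT_comp (f := fun k : nat => ln k.+1%:R - m)).
Qed.

(** Markov's inequality for [expR (lam * S)], whose expectation factors through
    [ge0_integral_prod_le]. The sign of [lam] is free, so one statement serves both tails. *)
Lemma chernoff_log_index (lam x : R) :
  (P [set w | (x <= lam * S w)%R] <=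
   (expR (n%:R * (50 * lam ^+ 2 / eta ^+ 2) - x))%:E)%E.
Proof.
have mA : measurable [set w | (x <= lam * S w)%R].
  by apply: measurable_superlevel; exact: measurable_funM.
have mexp : measurable_fun setT (fun w => (expR (lam * S w))%:E).
  apply/measurable_EFinP; apply: measurableT_comp => //.
  exact: measurable_funM.
have joint : (\int[P]_w (expR (lam * S w))%:E <=
    (expR (n%:R * (50 * lam ^+ 2 / eta ^+ 2)))%:E)%E.
  have := @ge0_integral_prod_le _ W R P 'I_n j
    (fun _ k => expR (lam * (ln k.+1%:R - m)))
    (fun=> expR (50 * lam ^+ 2 / eta ^+ 2)) mj
    (fun _ _ => expR_ge0 _) (fun=> expR_ge0 _)
    (fun t => log_index_mgf (mj t) eta01 (@j_ge t) lam (j_mean t))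
    (index_enum 'I_n) (index_enum_uniq _) setT 1 measurableT ler01.
  rewrite mul1r prodr_const card_ord -expRM_natl => h.
  apply: le_trans (h _); last by move=> k; rewrite setTI mul1e j_indep.
  rewrite le_eqVlt; apply/orP; left; apply/eqP; apply: eq_integral => w _.
  by rewrite /S mulr_sumr expR_sum.
rewrite expRD mulrC EFinM -lee_pdivrMl ?expR_gt0// -expRN opprK.
apply: le_trans joint.
rewrite -integral_cst//.
apply: (@le_trans _ _ (\int[P]_(w in [set w | (x <= lam * S w)%R])
    (expR (lam * S w))%:E)%E).
  apply: ge0_le_integral => //=.
  - exact: measurable_funTS.
  - by move=> w /= h; rewrite lee_fin ler_expR.
by apply: ge0_subset_integral => //.
Qed.

Lemma log_index_deviation (tau : R) : 0 <= tau ->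
  (P [set w | (tau < `|n%:R^-1 * \sum_t ln (j t w).+1%:R - m|)%R] <=
   (2 * expR (- (n%:R * (tau * eta) ^+ 2 / 200)))%:E)%E.
Proof.
move=> tau0; have /andP[eta0 eta1] := eta01.
have n0 : 0 < n%:R :> R by rewrite ltr0n.
(* This [lam] minimises [50 * lam ^+ 2 / eta ^+ 2 - lam * tau], with minimum
   [- (tau * eta) ^+ 2 / 200]. *)
pose lam := tau * eta ^+ 2 / 100; pose x := n%:R * lam * tau.
have lam0 : 0 <= lam by rewrite /lam mulr_ge0// mulr_ge0// exprn_ge0// ltW.
have mean_S w : n%:R^-1 * (\sum_t ln (j t w).+1%:R) - m = n%:R^-1 * S w.
  rewrite /S sumrB sumr_const card_ord mulrBr -(mulr_natl m) (mulrA _ n%:R) mulVf ?mul1r//.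
  by rewrite gt_eqF.
have exponent b : b ^+ 2 = lam ^+ 2 ->
    n%:R * (50 * b ^+ 2 / eta ^+ 2) - x = - (n%:R * (tau * eta) ^+ 2 / 200).
  move=> ->; rewrite /x /lam; field; rewrite gt_eqF//.
have mset (b : R) : measurable [set w | (x <= b * S w)%R].
  by apply: measurable_superlevel; exact: measurable_funM.
apply: (@le_trans _ _ (P ([set w | (x <= lam * S w)%R] `|`
    [set w | (x <= (- lam) * S w)%R]))).
  apply: le_measure; rewrite ?inE.
  - apply: measurable_strict_superlevel; under eq_fun do rewrite mean_S.
    by apply: measurableT_comp => //; exact: measurable_funM.
  - exact: measurableU.
  move=> w /=; rewrite mean_S.
  have key (s : R) : tau < n%:R^-1 * s -> x <= lam * s.
    rewrite ltr_pdivlMl// => /ltW h.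
    by rewrite /x mulrAC mulrC ler_wpM2l.
  rewrite ltr_normr -mulrN => /orP[/key|/key]; first by left.
  by rewrite mulrN -mulNr; right.
apply: le_trans (measureU2 P (mset lam) (mset (- lam))) _.
rewrite mulr_natl mulr2n EFinD; apply: leeD.
  by apply: le_trans (chernoff_log_index _ _) _; rewrite exponent.
by apply: le_trans (chernoff_log_index _ _) _; rewrite exponent// sqrrN.
Qed.

End concentration.

(** * Independence of the pairs formed by a symbol and its codebook *)

Section source_codebook_independence.
Context d (W : measurableType d) (R : realType) (P : probability W R).
Context dX (TX : measurableType dX) (PX : probability TX R).
Context dY (TY : measurableType dY) (Q : probability TY R).

(** Only a pi-system: it generates the sigma-algebra of the pair, and its members split into the two
    events that [source_codebook_sample] controls. *)
Definition symbol_codebook_sigma (X : W -> TX) (C : nat -> W -> TY) :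
    set (set W) :=
  [set S | exists A B, [/\ sigma_of X A, codebook_sigma C B & S = A `&` B]].

Lemma sigma_of_preimage d' (T : measurableType d') (Z : W -> T) A :
  measurable A -> sigma_of Z (Z @^-1` A).
Proof. by move=> mA; exists A => //; rewrite setTI. Qed.

Lemma sigma_of_measurable d' (T : measurableType d') (Z : {RV P >-> T}) :
  sigma_of Z `<=` measurable.
Proof. by move=> _ [A mA <-]; exact: measurable_funPT. Qed.

Lemma codebook_sigma_preimage (C : nat -> W -> TY) j B :
  measurable B -> codebook_sigma C (C j @^-1` B).
Proof.
by move=> mB; apply: sub_sigma_algebra; exists j => //; exact: sigma_of_preimage.
Qed.

Lemma codebook_sigma_measurable (C : nat -> {RV P >-> TY}) :
  codebook_sigma (fun j => C j : W -> TY) `<=` measurable.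
Proof.
apply: smallest_sub; first exact: sigma_algebra_measurable.
by move=> S [j _]; exact: sigma_of_measurable.
Qed.

Lemma symbol_codebook_sigma_setI (X : W -> TX) (C : nat -> W -> TY) :
  setI_closed (symbol_codebook_sigma X C).
Proof.
move=> _ _ [_ [B1 [[A1 mA1 <-] sB1 ->]]] [_ [B2 [[A2 mA2 <-] sB2 ->]]].
exists (X @^-1` (A1 `&` A2)), (B1 `&` B2); split.
- exact/sigma_of_preimage/measurableI.
- pose T := g_sigma_algebraType (\bigcup_(j in [set: nat]) sigma_of (C j)).
  exact: (@measurableI _ T).
- by rewrite !setTI preimage_setI setIACA.
Qed.

Lemma symbol_codebook_sigmaT (X : W -> TX) (C : nat -> W -> TY) :
  symbol_codebook_sigma X C setT.
Proof.
exists setT, setT; split; rewrite ?setIT//.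
- by rewrite -(preimage_setT X); exact: sigma_of_preimage.
- by rewrite -(preimage_setT (C 0%N)); exact: codebook_sigma_preimage.
Qed.

Lemma symbol_codebook_sigma_match_index (rho : TX -> TY -> R) (dist : R)
    (X : W -> TX) (C : nat -> W -> TY) k :
  measurable_fun [set: TX * TY] (fun z => rho z.1 z.2) ->
  <<s symbol_codebook_sigma X C >>
    [set w | match_index rho dist (X w) (C^~ w) = k].
Proof.
move=> mrho; pose T := g_sigma_algebraType (symbol_codebook_sigma X C).
apply: (@measurable_match_index_preimage _ _ _ _ _ _ _ mrho _ T X C k).
- move=> _ A mA; rewrite setTI; apply: sub_sigma_algebra.
  exists (X @^-1` A), setT; split; rewrite ?setIT//; first exact: sigma_of_preimage.
  by rewrite -(preimage_setT (C 0%N)); exact: codebook_sigma_preimage.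
- move=> j _ B mB; rewrite setTI; apply: sub_sigma_algebra.
  exists setT, (C j @^-1` B); split; rewrite ?setTI//.
    by rewrite -(preimage_setT X); exact: sigma_of_preimage.
  exact: codebook_sigma_preimage.
Qed.

Lemma symbol_codebook_independent (I : choiceType) (X : I -> {RV P >-> TX})
    (C : I -> nat -> {RV P >-> TY}) (t : I) (A B : set W) :
  source_codebook_sample PX Q X C ->
  sigma_of (X t) A -> codebook_sigma (fun j => C t j : W -> TY) B ->
  P (A `&` B) = (P A * P B)%E.
Proof.
move=> [_ _ indep] sA sB.
pose S (k : (I + I)%type) := if k is inl _ then A else B.
have := indep [fset inl t; inr t]%fset S.
rewrite bigcap_fset !big_fsetU1 ?inE//= !big_seq_fset1; apply.
by move=> i; rewrite !inE => /orP[]/eqP ->.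
Qed.

Lemma codewords_product (I : choiceType) (X : I -> {RV P >-> TX})
    (C : I -> nat -> {RV P >-> TY}) (t : I) :
  source_codebook_sample PX Q X C ->
  forall k (A : set TX) (B : nat -> set TY), measurable A -> (forall j, measurable (B j)) ->
  P (X t @^-1` A `&` \big[setI/setT]_(j < k) (C t j @^-1` B j)) =
  (PX A * \prod_(j < k) Q (B j))%E.
Proof.
move=> scs k A B mA mB; have [[lawX _] iidC _] := scs.
have [lawC indepC] := iidC t.
rewrite (symbol_codebook_independent (t := t) scs); last 2 first.
- exact: sigma_of_preimage.
- pose T := g_sigma_algebraType
    (\bigcup_(j in [set: nat]) sigma_of (C t j : W -> TY)).
  apply: (@bigsetI_measurable _ T) => j _.
  exact: (@codebook_sigma_preimage (fun j => C t j)).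
congr (_ * _)%E; first exact: lawX.
have := indepC [fset j in iota 0 k]%fset (fun j => C t j @^-1` B j).
have iotaE : perm_eq [fset j in iota 0 k]%fset (index_iota 0 k).
  by rewrite /index_iota subn0 uniq_perm ?iota_uniq// => i; rewrite !inE.
rewrite bigcap_fset !(perm_big _ iotaE)/= !big_mkord => -> //.
  by apply: eq_bigr => j _; exact: lawC.
by move=> j _; exact: sigma_of_preimage.
Qed.

(** On the pi-systems each event is a symbol event met with a codebook event; the product over
    ['I_n + 'I_n] is regrouped by index, and each pair of factors merges by independence inside the
    pair. *)
Lemma symbol_codebook_family_independent n (X : 'I_n -> {RV P >-> TX})
    (C : 'I_n -> nat -> {RV P >-> TY}) (A : 'I_n -> set W) :
  source_codebook_sample PX Q X C ->
  (forall t, <<s symbol_codebook_sigma (X t) (fun j => C t j) >> (A t)) ->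
  P (\big[setI/setT]_t A t) = (\prod_t P (A t))%E.
Proof.
move=> scs; apply: independent_family_g_sigma_algebra.
- move=> t _ [S [S' [sS sS' ->]]]; apply: measurableI.
    exact: sigma_of_measurable sS.
  exact: codebook_sigma_measurable sS'.
- by move=> t; exact: symbol_codebook_sigma_setI.
- by move=> t; exact: symbol_codebook_sigmaT.
move=> {}A /(_ _)/cid-/all_sig[S] /(_ _)/cid-/all_sig[S' h].
have [_ _ indep] := scs.
pose SS (k : ('I_n + 'I_n)%type) :=
  match k with inl t => S t | inr t => S' t end.
have := indep [fset k in index_enum ('I_n + 'I_n)%type]%fset SS.
have enumE : perm_eq [fset k in index_enum ('I_n + 'I_n)%type]%fset
    (index_enum ('I_n + 'I_n)%type).
  by rewrite uniq_perm ?index_enum_uniq// => i; rewrite !inE.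
rewrite bigcap_fset !(perm_big _ enumE)/= !big_sumType/=.
rewrite -!big_split/= => H.
rewrite (eq_bigr (fun t => S t `&` S' t)) => [|t _]; last by have [] := h t.
rewrite H => [|[t|t] _]; last 2 first.
- by have [] := h t.
- by have [] := h t.
apply: eq_bigr => t _; have [sS sS' ->] := h t.
by rewrite (symbol_codebook_independent (t := t) scs sS sS').
Qed.

End source_codebook_independence.

(** * From the extended-real cost to the real surrogate *)

Section log_first_match_measurable.
Context (R : realType) dX dY (TX : measurableType dX) (TY : measurableType dY).
Variables (rho : TX -> TY -> R) (dist : R).
Hypothesis mrho : measurable_fun [set: TX * TY] (fun z => rho z.1 z.2).
Context d (W : measurableType d) (P : probability W R).
Variables (X : {RV P >-> TX}) (C : nat -> {RV P >-> TY}).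
Let N : set W := \bigcap_k unmatched rho dist X (fun j => C j : W -> TY) k.
Let Z w : R := ln (match_index rho dist (X w) (fun j => C j w)).+1%:R.

Let mN : measurable N.
Proof. by apply: bigcap_measurable => // k _; exact: measurable_unmatched. Qed.

Let mZ : measurable_fun setT (fun w => (Z w)%:E).
Proof.
apply/measurable_EFinP; apply: (measurableT_comp (f := fun k : nat => ln k.+1%:R)) => //.
exact: measurable_match_index.
Qed.

Lemma log_first_match_off_never w : ~ N w ->
  log_first_match rho dist (X w) (fun j => C j w) = (Z w)%:E.
Proof.
move=> Nw; apply: log_first_matchE; apply/not_existsP => h.
apply: Nw; apply/never_unmatchedP => j.
by rewrite ltNge; apply/negP; exact: h.
Qed.

(** Adding infinity on [N] absorbs the junk value of [Z] there, so one formula gives both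
    measurability and the integral. *)
Let log_first_match_patch :
  (fun w => log_first_match rho dist (X w) (fun j => C j w)) =
  (fun w => (Z w)%:E + (cst +oo \_ N) w)%E.
Proof.
apply/funext => w; rewrite /patch; case: ifPn => wN.
  rewrite log_first_match_never ?addey// => j.
  by move: wN; rewrite inE => /never_unmatchedP; exact.
by rewrite log_first_match_off_never ?adde0//; rewrite notin_setE in wN.
Qed.

Lemma measurable_log_first_match :
  measurable_fun setT (fun w => log_first_match rho dist (X w) (fun j => C j w)).
Proof.
rewrite log_first_match_patch; apply: emeasurable_funD => //.
by apply/(measurable_restrictT _ _).1 => //; exact: measurable_cst.
Qed.

Lemma mean_costE : P N = 0%E -> mean_cost rho dist X C = (\int[P]_w (Z w)%:E)%E.
Proof.
move=> PN; rewrite /mean_cost log_first_match_patch ge0_integralD//.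
- rewrite -integral_mkcond.
  rewrite (_ : (\int[P]_(w in N) cst +oo w = 0)%E) ?adde0//.
  by transitivity (+oo * P N)%E; [exact: integral_cst|rewrite PN mule0].
- by move=> w _; rewrite lee_fin ln_ge0// ler1n.
- by move=> w _; rewrite /patch; case: ifPn => _; rewrite ?leey.
- by apply/(measurable_restrictT _ _).1 => //; exact: measurable_cst.
Qed.

End log_first_match_measurable.

(** * Transfer of the mean, choice of the constant, and removal of null events *)

Theorem proposition1 (R : realType) (delta0 : R)
    (hdelta0 : 0 < delta0 /\ delta0 < 1) :
  exists c : R, 0 < c /\
  forall (dX dY : measure_display)
    (TX : measurableType dX) (TY : measurableType dY)
    (PX : probability TX R) (Q : probability TY R)
    (rho : TX -> TY -> R) (dist : R) (delta eta : R) (n : nat),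
  measurable_fun [set: TX * TY] (fun z : TX * TY => rho z.1 z.2) ->
  0 < delta -> delta <= delta0 ->
  0 < eta -> (forall x : TX, (eta%:E < d_match_prob rho dist Q x)%E) ->
  (0 < n)%N ->
  (* a generic pair (X, C), X ~ PX and C ~ Q independent, giving the mean *)
  forall (d' : measure_display) (W' : measurableType d')
    (P' : probability W' R)
    (X' : {RV P' >-> TX}) (C' : nat -> {RV P' >-> TY}),
  source_codebook_sample PX Q (fun _ : unit => X') (fun _ : unit => C') ->
  (* the observed sample *)
  forall (d : measure_display) (W : measurableType d) (P : probability W R)
    (X : 'I_n -> {RV P >-> TX}) (C : 'I_n -> nat -> {RV P >-> TY}),
  source_codebook_sample PX Q X C ->
  ((1 - delta)%:E <=
     P [set w | `| (n%:R^-1)%:E *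
                   (\sum_(t < n)
                      log_first_match rho dist (X t w) (fun j => C t j w))
                 - mean_cost rho dist X' C' |
                <= (c / eta * Num.sqrt (n%:R^-1 * ln (1 / delta)))%:E ])%E.
Proof.
have [d0 d1] := hdelta0; pose L0 := - ln delta0.
have L0_gt0 : 0 < L0 by rewrite oppr_gt0 ln_lt0// d0.
(* Chosen so that [L0 <= L] gives [L + 1 <= c ^+ 2 / 200 * L]: the extra 1 in the exponent pays for
   the factor 2, because [2 <= expR 1]. *)
pose c := 200 * (1 + L0^-1).
have c_gt0 : 0 < c by rewrite mulr_gt0// addr_gt0// invr_gt0.
exists c; split => // dX dY TX TY PX Q rho dist delta eta n mrho delta_gt0 delta_le.
move=> eta_gt0 eta_lt n_gt0 d' W' P' X' C' scs' d W P X C scs.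
have eta_lt1 : eta < 1.
  rewrite -lte_fin; apply: lt_le_trans (eta_lt point) _.
  exact/probability_le1/measurable_match.
have eta_le x : (eta%:E <= d_match_prob rho dist Q x)%E by exact: ltW.
have eta01 : 0 < eta <= 1 by rewrite eta_gt0 ltW.
have r01 : 0 <= 1 - eta < 1 by rewrite subr_ge0 ltW//= gtrBl.
have law' := codewords_product tt scs'.
have law t := codewords_product t scs.
have tail' := unmatched_le mrho law' (ltW eta_gt0) eta_le.
have tail t := unmatched_le mrho (law t) (ltW eta_gt0) eta_le.
have never' := never_unmatched_negligible mrho r01 tail'.
have never t := never_unmatched_negligible mrho r01 (tail t).
pose j' w := match_index rho dist (X' w) (fun i => C' i w).
pose j t w := match_index rho dist (X t w) (fun i => C t i w).
have mj' : measurable_fun setT j' by exact: measurable_match_index.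
have mj t : measurable_fun setT (j t) by exact: measurable_match_index.
have j_ge' k : (0 < k)%N ->
    (P' [set w | (k <= j' w)%N] <= ((1 - eta) ^+ k)%:E)%E.
  move=> k0; apply: le_trans (tail' k); apply: le_measure; rewrite ?inE.
  - exact: (measurable_nat_preimage [set i | (k <= i)%N]).
  - exact: measurable_unmatched.
  - exact: match_index_ge.
have j_ge t k : (0 < k)%N ->
    (P [set w | (k <= j t w)%N] <= ((1 - eta) ^+ k)%:E)%E.
  move=> k0; apply: le_trans (tail t k); apply: le_measure; rewrite ?inE.
  - exact: (measurable_nat_preimage [set i | (k <= i)%N]).
  - exact: measurable_unmatched.
  - exact: match_index_ge.
have ln_nat0 k : 0 <= ln k.+1%:R :> R by rewrite ln_ge0// ler1n.
have integral_ln dV (V : measurableType dV) (PV : probability V R) (jV : V -> nat) :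
    measurable_fun setT jV ->
    (\int[PV]_w (ln (jV w).+1%:R)%:E =
     \sum_(k <oo) (ln k.+1%:R)%:E * PV [set w | jV w = k])%E.
  move=> mjV.
  transitivity (\int[PV]_w ((ln (jV w).+1%:R)%:E * cst 1%E w))%E.
    by under [RHS]eq_integral do rewrite mule1.
  rewrite (ge0_integral_nat_fibers PV mjV ln_nat0)//.
  apply: eq_eseriesr => k _; rewrite setTI; congr (_ * _)%E.
  rewrite integral_cst ?mul1e//.
  exact: (measurable_nat_preimage [set k]).
have mean_ub := mean_log_le mj' eta01 j_ge'.
have mean_fin : (\int[P']_w (ln (j' w).+1%:R)%:E)%E \is a fin_num.
  rewrite ge0_fin_numE; first exact: le_lt_trans mean_ub (ltry _).
  by apply: integral_ge0 => w _; rewrite lee_fin.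
pose m := fine (\int[P']_w (ln (j' w).+1%:R)%:E)%E.
have mE : (\int[P']_w (ln (j' w).+1%:R)%:E = m%:E)%E by rewrite fineK.
(* Both means are series over index values, and their weights are differences of unmatched
   probabilities, equal on the two spaces. *)
have mean_j t : (\int[P]_w (ln (j t w).+1%:R)%:E = m%:E)%E.
  rewrite -mE !integral_ln//; apply: eq_eseriesr => k _; congr (_ * _)%E.
  rewrite (probability_match_index mrho k (never t)).
  rewrite (probability_match_index mrho k never').
  by rewrite !(unmatched_unique dist mrho (law t) law').
have costE : mean_cost rho dist X' C' = m%:E by rewrite (mean_costE mrho never').
have j_indep (k : 'I_n -> nat) :
    P (\big[setI/setT]_t [set w | j t w = k t]) =
    (\prod_t P [set w | j t w = k t])%E.
  apply: (symbol_codebook_family_independent scs) => t.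
  exact: symbol_codebook_sigma_match_index.
pose L := ln (1 / delta); pose tau := c / eta * Num.sqrt (n%:R^-1 * L).
have LE : L = - ln delta by rewrite /L div1r lnV// posrE.
have L0_le : L0 <= L by rewrite LE lerN2 ler_ln// posrE.
have tau0 : 0 <= tau by rewrite mulr_ge0 ?sqrtr_ge0// divr_ge0// ltW.
have dev := log_index_deviation n_gt0 mj eta01 j_ge j_indep mean_j tau0.
have bound : 2 * expR (- (n%:R * (tau * eta) ^+ 2 / 200)) <= delta.
  have -> : n%:R * (tau * eta) ^+ 2 / 200 = c ^+ 2 / 200 * L.
    have -> : tau * eta = c * Num.sqrt (n%:R^-1 * L).
      by rewrite /tau mulrAC divfK// gt_eqF.
    rewrite exprMn sqr_sqrtr.
      by field; rewrite pnatr_eq0 -lt0n.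
    by rewrite mulr_ge0 ?invr_ge0// (le_trans (ltW L0_gt0)).
  have cL : L + 1 <= c ^+ 2 / 200 * L.
    have L1 : 1 <= L0^-1 * L by rewrite mulrC ler_pdivlMr// mul1r.
    have iL0 : 0 < L0^-1 by rewrite invr_gt0.
    rewrite (_ : c ^+ 2 / 200 * L =
      200 * (1 + L0^-1) * (L + L0^-1 * L)); last by rewrite /c; field; rewrite gt_eqF.
    by move: (L0^-1) (L0^-1 * L) iL0 L1 => x y; nra.
  apply: (@le_trans _ _ (2 * expR (- (L + 1)))).
    by rewrite ler_wpM2l// ler_expR lerN2.
  rewrite opprD expRD LE opprK lnK ?posrE// mulrCA ger_pMr//.
  by rewrite expRN ler_pdivrMr ?expR_gt0// mul1r; have := expR_ge1Dx (1 : R); lra.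
pose Bad := [set w | (tau < `|n%:R^-1 * \sum_t ln (j t w).+1%:R - m|)%R].
pose N t : set W := \bigcap_k unmatched rho dist (X t) (fun i => C t i : W -> TY) k.
(* The null event that some cost is infinite; off it the extended-real average is the real one. *)
pose U := \big[setU/set0]_t N t.
have [mU PU] : measurable U /\ P U = 0%E.
  rewrite /U; elim/big_ind : _ => [|A B [mA PA] [mB PB]|t _].
  - by split => //; exact: measure0.
  - by split; [exact: measurableU|rewrite measureU0].
  - split; last exact: never.
    by apply: bigcap_measurable => // k _; exact: measurable_unmatched.
have mBad : measurable Bad.
  apply: measurable_strict_superlevel.
  apply: measurableT_comp => //; apply: measurable_funB => //.
  apply: measurable_funM => //; apply: measurable_sum => t.
  exact: (measurableT_comp (f := fun k : nat => ln k.+1%:R)).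
rewrite costE.
set G := [set w | _].
have mG : measurable G.
  have mf : measurable_fun setT (fun w => `|(n%:R^-1)%:E * (\sum_(t < n)
      log_first_match rho dist (X t w) (fun i => C t i w)) - m%:E|)%E.
    apply: measurableT_comp => //; apply: emeasurable_funB => //.
    apply: emeasurable_funM => //; apply: emeasurable_sum => t _.
    exact: measurable_log_first_match.
  have := mf measurableT _ (emeasurable_itv `]-oo, tau%:E]).
  by rewrite setTI; congr measurable; apply/seteqP; split => w;
    rewrite /= in_itv/=.
have sub : ~` (Bad `|` U) `<=` G.
  move=> w /not_orP[/negP]; rewrite -leNgt => wBad wU; rewrite /G/=.
  rewrite (eq_bigr (fun t => (ln (j t w).+1%:R)%:E)) => [|t _].
    by rewrite sumEFin -EFinM -EFinB lee_fin.
  apply: log_first_match_off_never => wN; apply: wU.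
  by rewrite /U (bigD1 t)//=; left.
have mBU : measurable (Bad `|` U) by exact: measurableU.
apply: (@le_trans _ _ (P (~` (Bad `|` U)))); last first.
  by apply: le_measure; rewrite ?inE//; exact: measurableC.
rewrite probability_setC// measureU0// EFinB leeB//.
by apply: le_trans dev _; rewrite lee_fin.
Qed.
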